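(* Let $K$ be a prime link diagram without curls and let $i\in K_1$ be a segment of $K$. Then the poset of Kauffman states of $K$ relative to $i$ is a finite distributive lattice.
   Context: Link diagrams. A link diagram $K$ is a projection of a link to the plane that is injective except for finitely many transversal double points (crossing points). It is regarded as a cellular decomposition of the oriented sphere $S^2$: $K_0$ is the set of crossing points (nonempty), $K_1$ the set of segments (edges; every crossing point is incident to four segments and every segment to two crossing points), $K_2$ the set of regions of the complement; $|K_1|=2|K_0|$ and $|K_2|=|K_0|+2$ (so $K$ is connected). A curl is a monogon region; $K$ is without curls if it has no monogon. ''Prime link diagram'' means: the link is prime (not the connected sum of two nontrivial links), and the diagram is prime, i.e. every simple closed curve in $S^2$ meeting $K$ transversally in exactly two points, both interior points of segments, bounds on one side a disc containing no crossing points. ''Clockwise'' is with respect to the fixed orientation of the plane. Kauffman states. Let $i\in K_1$, with adjacent regions $R_i,R_i'$. A marker is a pair $(x,R)$ with $x\in K_0$, $R\in K_2$, $x$ incident to $R$. A Kauffman state relative to $i$ is a set of markers such that each crossing point is used in exactly one marker, each region other than $R_i,R_i'$ is used in exactly one marker, and $R_i,R_i'$ are used in no marker. Let $j$ be a segment with endpoints $x,y$ and adjacent regions $R_1,R_2$ such that going clockwise around $x$ one passes from $R_1$ to $R_2$ when crossing $j$. A state $\mathcal S'$ is obtained from $\mathcal S$ by a counterclockwise transposition at $j$ if $\mathcal S$ contains $(x,R_2),(y,R_1)$, $\mathcal S'$ contains $(x,R_1),(y,R_2)$, and all other markers agree. Put $\mathcal S_1<\mathcal S_2$ if a (nonempty)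 sequence of counterclockwise transpositions transforms $\mathcal S_1$ into $\mathcal S_2$. This is the partial order on Kauffman states. *)

(* Defs.v *)
(* MathComp, with MathComp-Analysis for links in R^3. *)
From mathcomp Require Import all_boot all_order all_algebra all_fingroup.
From mathcomp Require Import all_classical all_reals all_analysis.
Import Order.TTheory GRing.Theory Num.Theory numFieldNormedType.Exports.

Set Implicit Arguments.
Unset Strict Implicit.
Unset Printing Implicit Defensive.

(** * Link diagrams *)

(* A link diagram is a cellular decomposition of the oriented sphere, encoded
   as a combinatorial map.  A dart is a segment together with one of its two
   ends, seen as leaving the crossing point at that end.
   - [node] turns a dart counterclockwise about its crossing point, to the next
     of the four darts there;
   - [edge] exchanges the two ends of a segment.
   The region of a dart is the one on its left, which fills the corner from [x]
   to [node x].  [face] sends a dart to the next one along the boundary of that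
   region: go to the other end of the segment, then take the first dart
   clockwise.
   [upper x] says that the strand of [x] is the overcrossing one. *)
Definition face_of (D : finType) (node edge : {perm D}) : {perm D} :=
  (edge * node^-1)%g.

Record link_diagram := LinkDiagram {
  dart :> finType;
  node : {perm dart};
  edge : {perm dart};
  upper : pred dart;
  dart_neq0 : 0 < #|dart|;
  node4 : forall x, #|porbit node x| = 4;
  edge2 : forall x, #|porbit edge x| = 2;
  diagram_connected :
    forall x y, connect [rel a b | (b == node a) || (b == edge a)] x y;
  diagram_planar : #|porbits (face_of node edge)| = #|porbits node| + 2;
  upper_node : forall x, upper (node x) = ~~ upper x
}.

Section Diagram.
Variable K : link_diagram.
Implicit Types (x y : K) (c s r : {set K}).

Definition crossing x : {set K} := porbit (node K) x.
Definition segment x : {set K} := porbit (edge K) x.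
Definition region x : {set K} := porbit (face_of (node K) (edge K)) x.

Definition crossings : {set {set K}} := porbits (node K).
Definition segments : {set {set K}} := porbits (edge K).
Definition regions : {set {set K}} := porbits (face_of (node K) (edge K)).

(* A crossing point and a region are incident if they share a corner; a segment
   and a region are adjacent if the region lies to the left of the segment in
   one of its two directions.  Both mean having a dart in common. *)
Definition incident c r : bool := ~~ [disjoint c & r].
Definition adjacent s r : bool := ~~ [disjoint s & r].

Definition without_curls : Prop := forall r, r \in regions -> #|r| != 1.

(** ** Prime diagrams *)

(* A simple closed curve that meets K transversally in one interior point of
   each of the segments of [x] and [y] consists of an arc in the region on the
   left of both [x] and [y] and an arc in the region on the right of both. *)
Definition curve_through x y : Prop :=
  [/\ segment x != segment y, region x = region y
    & region (edge K x) = region (edge K y)].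

(* [uncut x y] is moving along K without traversing the curve; as K is
   connected, all crossing points on one side of the curve are reached in this
   way from the halves of the two cut segments lying on that side. *)
Definition uncut x y : rel K := [rel a b | (b == node K a) ||
  [&& b == edge K a, a \notin segment x & a \notin segment y]].

Definition reached x y a : {set {set K}} :=
  [set crossing b | b in [pred b | connect (uncut x y) a b]].

(* The ends [x] and [edge y] are on one side of the curve, [edge x] and [y] on
   the other one. *)
Definition curve_side1 x y := reached x y x :|: reached x y (edge K y).
Definition curve_side2 x y := reached x y (edge K x) :|: reached x y y.

(* Curves meeting one segment twice are left out: they bound a disc which meets
   K only in a part of that segment, since a segment has different regions on
   its two sides. *)
Definition prime_diagram : Prop :=
  forall x y, curve_through x y ->
  curve_side1 x y = finset.set0 \/ curve_side2 x y = finset.set0.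

(** ** Kauffman states *)

Definition marker : finType := ({set K} * {set K})%type.

Definition is_marker (m : marker) : bool :=
  [&& m.1 \in crossings, m.2 \in regions & incident m.1 m.2].

Variable i : {set K}.

Definition is_state (S : {set marker}) : bool :=
  [&& [forall m in S, is_marker m],
      [forall c in crossings, #|[set m in S | m.1 == c]%SET| == 1]
    & [forall r in regions,
         #|[set m in S | m.2 == r]%SET| == (~~ adjacent i r : nat)]].

Definition state : finType := {S : {set marker} | is_state S}.

(* Let [a] be the dart of the segment j at its end x, so that [edge a] is the
   dart of j at its other end y.  Going clockwise around x and crossing j, one
   passes from the region R_1 = [region a] to the region
   R_2 = [region (edge a)]. *)
Definition ccw_transposition_at (a : K) (S S' : {set marker}) : bool :=
  let x := crossing a in let y := crossing (edge K a) in
  let R1 := region a in let R2 := region (edge K a) in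
  [&& (x, R2) \in S, (y, R1) \in S, (x, R1) \in S', (y, R2) \in S'
    & S :\: [set (x, R2); (y, R1)]%SET == S' :\: [set (x, R1); (y, R2)]%SET].

Definition ccw_transposition : rel state :=
  [rel S S' | [exists a, ccw_transposition_at a (val S) (val S')]].

Definition state_lt (S S' : state) : bool :=
  [exists T, ccw_transposition S T && connect ccw_transposition T S'].

End Diagram.

(** * Links *)

Local Open Scope classical_set_scope.
Local Open Scope ring_scope.

Section Links.
Variable R : realType.
Notation point := 'rV[R]_3.

Definition xcoord (p : point) : R := p ord0 (inord 0).
Definition ycoord (p : point) : R := p ord0 (inord 1).
Definition height (p : point) : R := p ord0 (inord 2).

(* Closed polygons are given by the positions [v] of their vertices and the
   permutation [s] sending a vertex to the next one on its component.
   Components have at least three vertices as soon as [embedded] holds. *)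
Section Polygons.
Variables (n : nat) (v : 'I_n.+1 -> point) (s : 'S_n.+1).

Definition polygon_point (k : 'I_n.+1) (t : R) : point :=
  v k + t *: (v (s k) - v k).

Definition polygons : set point :=
  [set p | exists k t, 0 <= t < 1 /\ p = polygon_point k t].

Definition embedded : Prop := forall k k' t t',
  0 <= t < 1 -> 0 <= t' < 1 -> polygon_point k t = polygon_point k' t' ->
  k = k' /\ t = t'.

End Polygons.

Definition is_link (L : set point) : Prop :=
  exists (n : nat) (v : 'I_n.+1 -> point) (s : 'S_n.+1),
    embedded v s /\ L = polygons v s.

Definition homeomorphism (f : point -> point) : Prop :=
  continuous f /\
  exists g : point -> point, [/\ continuous g, cancel f g & cancel g f].

(* An isotopy over [0, 1] extends to all times by being constant outside. *)
Definition isotopic (A B : set point) : Prop :=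
  exists H : R -> point -> point,
    [/\ continuous (fun q : R * point => H q.1 q.2),
        forall t, homeomorphism (H t),
        forall p, H 0 p = p
      & H 1 @` A = B].

Definition trivial_link (L : set point) : Prop :=
  exists L', [/\ is_link L', isotopic L L' & forall p, L' p -> height p = 0].

Definition straight (p q : point) : set point :=
  [set a | exists t, 0 <= t <= 1 /\ a = p + t *: (q - p)].

(* The sphere meeting a connected sum in two points is taken to be the plane
   x = 0 together with the point at infinity. *)
Definition connected_sum (L L1 L2 : set point) : Prop :=
  exists (A : set point) (p q : point),
    let A1 := (A `&` [set a | xcoord a <= 0]) `|` straight p q in
    let A2 := (A `&` [set a | 0 <= xcoord a]) `|` straight p q in
    [/\ isotopic L A, p <> q, A `&` [set a | xcoord a = 0] = [set p; q],
        is_link A1 /\ isotopic L1 A1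
      & is_link A2 /\ isotopic L2 A2].

Definition prime_link (L : set point) : Prop :=
  ~ exists L1 L2, [/\ is_link L1, is_link L2, connected_sum L L1 L2,
                      ~ trivial_link L1 & ~ trivial_link L2].

(** ** Projection to the plane *)

Definition same_projection (p q : point) : Prop :=
  xcoord p = xcoord q /\ ycoord p = ycoord q.

Definition plane_det (p q : point) : R :=
  xcoord p * ycoord q - ycoord p * xcoord q.

Section Projection.
Variables (K : link_diagram) (n : nat) (v : 'I_n.+1 -> point) (s : 'S_n.+1).
(* [over d] is the vertex lying over the crossing point of [d] on the strand of
   [d]; [fwd d] says that [d] leaves it in the direction of [s]. *)
Variables (over : K -> 'I_n.+1) (fwd : pred K).

Definition direction (d : K) : point :=
  v (if fwd d then s (over d) else (s^-1)%g (over d)) - v (over d).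

Record projects_onto : Prop := ProjectsOnto {
  strand_over : forall d d',
    over d = over d' <-> d' = d \/ d' = node K (node K d);
  strand_fwd : forall d, fwd (node K (node K d)) = ~~ fwd d;
  (* the double points are exactly the crossing points *)
  double_points : forall k k' t t', 0 <= t < 1 -> 0 <= t' < 1 ->
    same_projection (polygon_point v s k t) (polygon_point v s k' t') <->
    (k = k' /\ t = t') \/
    [/\ t = 0, t' = 0 & exists d, k = over d /\ k' = over (node K d)];
  (* Each of the four consecutive turns is by less than half a turn, so that
     they add up to one full counterclockwise turn: the strands are
     transverse, and the darts are in counterclockwise order. *)
  crossing_ccw : forall d, 0 < plane_det (direction d) (direction (node K d));
  crossing_height : forall d,
    upper d = (height (v (over (node K d))) < height (v (over d)));
  segment_path : forall d, fwd d -> ~~ fwd (edge K d) /\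
    exists m : nat, [/\ (0 < m)%N, iter m s (over d) = over (edge K d) &
      forall l : nat, (0 < l < m)%N -> iter l s (over d) \notin codom over];
  (* every component passes through a crossing point, K having no segment
     without end points *)
  component_crossing : forall k, exists d (m : nat), iter m s (over d) = k
}.

End Projection.

Definition diagram_of (K : link_diagram) (L : set point) : Prop :=
  exists (n : nat) (v : 'I_n.+1 -> point) (s : 'S_n.+1)
         (over : K -> 'I_n.+1) (fwd : pred K),
    [/\ embedded v s, L = polygons v s & projects_onto v s over fwd].

End Links.

(* Main.v *)
(* A state picks one corner at each crossing point.  The corners are the edges
   of the bipartite graph of crossing points and regions, whose faces are the
   segments.  Two states differ by a function on corners with zero sum at each
   crossing point and region; on the sphere it is the coboundary of a height,
   an integer function on segments, unique once it vanishes on the segment i.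
   The heights of the states relative to a fixed one are all the solutions of
   a system of bounds on differences, hence closed under pointwise minimum and
   maximum, and a transposition adds 1 to the height of one segment.

   It remains to see that if S lies strictly below S', some transposition of S
   stays below S'.  Otherwise there is a cycle of segments, away from the two
   regions at i, turning over corners which no state contains.  But in a prime
   diagram k crossing points (not all, k > 0) are incident to at least k + 3
   regions, so by Hall's theorem every other corner lies in some state. *)
From HB Require Import structures.
Require Import Defs.
From mathcomp Require Import all_boot all_order all_algebra all_fingroup.
From mathcomp Require Import zify lra.
Set Implicit Arguments.
Unset Strict Implicit.
Unset Printing Implicit Defensive.
Import Order.TTheory GRing.Theory Num.Theory.

(** * Distributive lattices of integer functions *)

Lemma fin_lower_bound (S : finType) (le : rel S) (x0 : S) :
  reflexive le -> transitive le ->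
  (forall x y, exists z, le z x && le z y) -> exists z, forall x, le z x.
Proof.
move=> le_refl le_trans dir.
suff [z zP] : exists z, forall x, x \in enum S -> le z x.
  by exists z => x; apply: zP; rewrite mem_enum.
elim: (enum S) => [|x s [z zP]]; first by exists x0.
have [t /andP[tx tz]] := dir x z; exists t => y; rewrite inE => /predU1P[-> //|ys].
exact: le_trans tz (zP y ys).
Qed.

(** Being injective, [h] pulls back the lattice laws and distributivity from integer functions under
    pointwise minimum and maximum; finiteness and [x0] supply the bottom and the top. *)
Lemma pointwise_lattice (S I : finType) (h : S -> I -> int) (x0 : S) :
  (forall x y, h x =1 h y -> x = y) ->
  (forall x y, exists z, forall i, h z i = Order.min (h x i) (h y i)) ->
  (forall x y, exists z, forall i, h z i = Order.max (h x i) (h y i)) ->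
  exists (d : Order.disp_t) (T : finTBDistrLatticeType d) (f : S -> T),
    bijective f /\
    forall x y, (f x <= f y)%O <-> forall i, (h x i <= h y i)%O.
Proof.
move=> h_inj min_ex max_ex.
have /fin_all_exists[meet' meet'P] : forall u : S * S, exists z,
  forall i, h z i = Order.min (h u.1 i) (h u.2 i) by case.
have /fin_all_exists[join' join'P] : forall u : S * S, exists z,
  forall i, h z i = Order.max (h u.1 i) (h u.2 i) by case.
pose meet x y := meet' (x, y); pose join x y := join' (x, y).
have meetE x y i : h (meet x y) i = Order.min (h x i) (h y i) := meet'P (x, y) i.
have joinE x y i : h (join x y) i = Order.max (h x i) (h y i) := join'P (x, y) i.
pose le x y := [forall i, (h x i <= h y i)%O].
have le_refl : reflexive le by move=> x; apply/forallP.
have le_trans : transitive le.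
  move=> y x z /forallP xy /forallP yz; apply/forallP => i.
  exact: Order.POrderTheory.le_trans (xy i) (yz i).
have [bot botP] : exists z, forall x, le z x.
  apply: fin_lower_bound => // x y; exists (meet x y).
  by apply/andP; split; apply/forallP => i; rewrite meetE ge_min lexx ?orbT.
have [top topP] : exists z, forall x, le x z.
  apply: (@fin_lower_bound _ (fun x y => le y x)) => // [y x z xy yz|x y].
    exact: le_trans yz xy.
  exists (join x y).
  by apply/andP; split; apply/forallP => i; rewrite joinE le_max lexx ?orbT.
have le_def x y : le x y = (meet x y == x).
  apply/forallP/eqP => [xy|<- i]; last by rewrite meetE ge_min lexx orbT.
  by apply: h_inj => i; rewrite meetE; apply/min_idPl.
pose dl := @Order.isMeetJoinDistrLattice.Build (Order.Disp tt tt) S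
  le (fun x y => (y != x) && le x y) meet join le_def (fun _ _ => erefl).
have mC : commutative meet by move=> x y; apply: h_inj => i; rewrite !meetE minC.
have jC : commutative join by move=> x y; apply: h_inj => i; rewrite !joinE maxC.
have mA : associative meet by move=> x y z; apply: h_inj => i; rewrite !meetE minA.
have jA : associative join by move=> x y z; apply: h_inj => i; rewrite !joinE maxA.
have jK y x : meet x (join x y) = x.
  by apply: h_inj => i; rewrite meetE joinE; lia.
have mK y x : join x (meet x y) = x.
  by apply: h_inj => i; rewrite joinE meetE; lia.
have mUl : left_distributive meet join.
  by move=> x y z; apply: h_inj => i; rewrite !(joinE, meetE); lia.
have mxx : idempotent_op meet by move=> x; apply: h_inj => i; rewrite !meetE minxx.
pose T0 : finDistrLatticeType _ := HB.pack S (dl mC jC mA jA jK mK mUl mxx).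
pose T : finTBDistrLatticeType _ := HB.pack T0
  (@Order.hasBottom.Build _ T0 bot botP) (@Order.hasTop.Build _ T0 top topP).
exists _, T, id; split; first by exists id.
by move=> x y; split=> /forallP.
Qed.

(** * Hall's marriage theorem *)

Lemma bigcup_setDl (I T : finType) (N : I -> {set T}) (B : {set I}) D :
  \bigcup_(x in B) (N x :\: D) = (\bigcup_(x in B) N x) :\: D.
Proof.
apply/setP => y; rewrite in_setD; apply/bigcupP/andP => [[x xB]|[yD /bigcupP[x xB yx]]].
  by rewrite in_setD => /andP[-> yx]; split=> //; apply/bigcupP; exists x.
by exists x => //; rewrite in_setD yD.
Qed.

(** Induction on the size of [A]. If a nonempty proper subset is tight, with no more neighbours than
    elements, match it first and the rest of [A] with the other neighbours. Otherwise every such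
    subset has a neighbour to spare, and [x] may take any of its own. *)
Lemma hall_marriage (I T : finType) (t0 : T) (N : I -> {set T}) (A : {set I}) :
  (forall B : {set I}, B \subset A -> #|B| <= #|\bigcup_(x in B) N x|) ->
  exists2 f : I -> T, {in A &, injective f} & {in A, forall x, f x \in N x}.
Proof.
have [n] := ubnP #|A|; elim: n => // n IH in N A *; rewrite ltnS => An hallA.
pose nbr (B : {set I}) := \bigcup_(x in B) N x.
have nbrS (B : {set I}) x : x \in B -> N x \subset nbr B.
  by move=> xB; apply: (bigcup_sup x).
have [->|/set0Pn[x xA]] := eqVneq A set0.
  by exists (fun=> t0) => [x y|x]; rewrite inE.
have [/existsP[B]|/existsPn tight] := boolP
    [exists B : {set I}, [&& B \proper A, B != set0 & #|nbr B| <= #|B|]].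
  case/and3P => /andP[BA nAB] B0 tB.
  have ltB : #|B| < n by apply: leq_trans An; apply: proper_card; rewrite /proper BA.
  have ltD : #|A :\: B| < n.
    apply: leq_trans An; rewrite cardsD (setIidPr BA).
    by move: B0; rewrite -card_gt0; have := subset_leq_card BA; lia.
  have [f fI fN] := IH N B ltB (fun C CB => hallA C (subset_trans CB BA)).
  have [|g gI gN] := IH (fun x => N x :\: nbr B) _ ltD.
    (* Hall's condition for [B :|: C], less the at most [#|B|] neighbours of [B], is the condition
       for [C]. *)
    move=> C; rewrite subsetD => /andP[CA dCB].
    have := hallA (B :|: C); rewrite subUset BA CA bigcup_setU => /(_ isT).
    have := cardsUI B C; rewrite setIC disjoint_setI0 // cards0 addn0 => ->.
    rewrite bigcup_setDl -/(nbr B) -/(nbr C).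
    by rewrite -(cardsID (nbr B) (_ :|: _)) setUK setDUl setDv set0U; lia.
  exists (fun x => if x \in B then f x else g x) => [y z yA zA|y yA].
    have nbrf u : u \in B -> f u \in nbr B.
      by move=> uB; apply: subsetP (fN _ uB); apply: nbrS.
    have Ng u : u \in A -> u \notin B -> g u \notin nbr B.
      by move=> uA uB; have := gN u; rewrite !in_setD uB uA => /(_ isT)/andP[].
    case: ifPn => yB; case: ifPn => zB.
    - exact: fI.
    - by move=> fg; have := nbrf y yB; rewrite fg (negbTE (Ng z zA zB)).
    - by move=> gf; have := nbrf z zB; rewrite -gf (negbTE (Ng y yA yB)).
    - by apply: gI; rewrite in_setD ?yB ?zB.
  case: ifPn => yB; first exact: fN.
  by have := gN y; rewrite !in_setD yB yA => /(_ isT)/andP[].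
have [y yx] : exists y, y \in N x.
  by apply/card_gt0P; have := hallA [set x]; rewrite sub1set big_set1 cards1; apply.
have ltx : #|A :\ x| < n by move: An; rewrite (cardsD1 x A) xA.
have [|f fI fN] := IH (fun z => N z :\ y) _ ltx.
  move=> C CA; have [->|C0] := eqVneq C set0; first by rewrite cards0.
  (* [C] misses [x], so it is proper and not tight; removing [y] costs at most the spare
     neighbour. *)
  have := tight C; rewrite C0 /= properE (subset_trans CA (subsetDl _ _)) /=.
  have -> : ~~ (A \subset C).
    apply: contraL CA => /subset_trans AC; apply/negP => /AC/subsetP/(_ x xA).
    by rewrite !inE eqxx.
  rewrite -ltnNge bigcup_setDl -/(nbr C) (cardsD1 y (nbr C)).
  by case: (y \in nbr C); lia.
exists (fun z => if z == x then y else f z) => [u v uA vA|u uA].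
  have fy w : w \in A -> w != x -> f w \in N w :\ y.
    by move=> wA wx; apply: fN; rewrite in_setD1 wx.
  case: eqVneq => [->|ux]; case: eqVneq => [->|vx] // E.
  - by have := fy v vA vx; rewrite -E !inE eqxx.
  - by have := fy u uA ux; rewrite E !inE eqxx.
  - by apply: fI; rewrite ?in_setD1 ?ux ?vx.
case: eqVneq => [->//|ux].
by have := fN u; rewrite !in_setD1 ux uA => /(_ isT)/andP[].
Qed.

Local Open Scope ring_scope.

(** * Exact sequences of function spaces *)

Section FunctionMatrices.
Variable R : fieldType.

Definition fun_mx (I J : finType) (A : {set I}) (B : {set J}) (F : I -> J -> R)
  : 'M[R]_(#|A|, #|B|) := \matrix_(k, l) F (enum_val k) (enum_val l).

Definition fun_rv (I : finType) (A : {set I}) (u : I -> R) : 'rV[R]_#|A| :=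
  \row_k u (enum_val k).

Lemma fun_rvP (I : finType) (A : {set I}) (v : 'rV[R]_#|A|) :
  exists u, v = fun_rv A u.
Proof.
exists (fun i => \sum_k v 0 k * (enum_val k == i)%:R).
apply/rowP => k; rewrite mxE (bigD1 k) //= eqxx mulr1 big1 ?addr0 // => l lk.
by rewrite (inj_eq enum_val_inj) (negbTE lk) mulr0.
Qed.

Lemma fun_rv0 (J : finType) (B : {set J}) (u : J -> R) :
  fun_rv B u = 0 <-> forall j, j \in B -> u j = 0.
Proof.
split=> [/rowP u0 j jB|u0]; last first.
  by apply/rowP => k; rewrite !mxE u0 ?enum_valP.
by have := u0 (enum_rank_in jB j); rewrite !mxE enum_rankK_in.
Qed.

Section TwoSets.
Variables (I J : finType) (A : {set I}) (B : {set J}) (F : I -> J -> R).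

Lemma fun_rvM u :
  fun_rv A u *m fun_mx A B F = fun_rv B (fun j => \sum_(i in A) u i * F i j).
Proof.
apply/rowP => l; rewrite !mxE [RHS]big_enum_val.
by apply: eq_bigr => k _; rewrite !mxE.
Qed.

(** The hypothesis puts the kernel inside the line spanned by [w], so at most one dimension is
    lost. *)
Lemma rank_fun_mx_ge w :
  (forall u, (forall j, j \in B -> \sum_(i in A) u i * F i j = 0) ->
     exists c, forall i, i \in A -> u i = c * w i) ->
  (#|A| <= (\rank (fun_mx A B F)).+1)%N.
Proof.
move=> kerF; suff : (\rank (kermx (fun_mx A B F)) <= 1)%N.
  by rewrite mxrank_ker leq_subLR addn1.
apply: leq_trans (rank_leq_row (fun_rv A w)); apply/mxrankS/row_subP => k.
have [u uE] := fun_rvP (row k (kermx (fun_mx A B F))).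
have /kerF[c uc] : forall j, j \in B -> \sum_(i in A) u i * F i j = 0.
  by apply/fun_rv0; rewrite -fun_rvM -uE; apply/sub_kermxP; rewrite row_sub.
apply/sub_rVP; exists c; rewrite uE.
by apply/rowP => l; rewrite !mxE uc ?enum_valP.
Qed.

Lemma rank_fun_mx_lt w i :
  i \in A -> w i != 0 ->
  (forall j, j \in B -> \sum_(i in A) w i * F i j = 0) ->
  (\rank (fun_mx A B F) < #|A|)%N.
Proof.
move=> iA wi /fun_rv0; rewrite -fun_rvM => /sub_kermxP wk.
rewrite -subn_gt0 -mxrank_ker lt0n mxrank_eq0; apply/eqP => k0.
move: wk; rewrite k0 submx0 => /eqP w0; move: wi.
by rewrite ((fun_rv0 _ _).1 w0 i iA) eqxx.
Qed.

End TwoSets.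

Lemma fun_mx_tr (I J : finType) (A : {set I}) (B : {set J}) (F : I -> J -> R) :
  (fun_mx A B F)^T = fun_mx B A (fun j i => F i j).
Proof. by apply/matrixP => k l; rewrite !mxE. Qed.

Section Exact.
Variables (I J L : finType) (A : {set I}) (B : {set J}) (C : {set L}).
Variables (F : I -> J -> R) (G : J -> L -> R).

Lemma sub_fun_mxP f :
  (fun_rv B f <= fun_mx A B F)%MS ->
  exists u, forall j, j \in B -> f j = \sum_(i in A) u i * F i j.
Proof.
move=> /submxP[v]; have [u ->] := fun_rvP v; rewrite fun_rvM => /rowP fE.
exists u => j jB; have := fE (enum_rank_in jB j).
by rewrite !mxE enum_rankK_in.
Qed.

(** The two kernel conditions give ranks at least [#|A| - 1] and [#|C| - 1]. Hence the kernel of [G]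
    has dimension at most [#|B| - #|C| + 1], which is at most [#|A| - 1], and the image of [F],
    lying inside it, fills it. *)
Lemma exact_of_card wF wG :
  (forall i l, i \in A -> l \in C -> \sum_(j in B) F i j * G j l = 0) ->
  (forall u, (forall j, j \in B -> \sum_(i in A) u i * F i j = 0) ->
     exists c, forall i, i \in A -> u i = c * wF i) ->
  (forall v, (forall j, j \in B -> \sum_(l in C) v l * G j l = 0) ->
     exists c, forall l, l \in C -> v l = c * wG l) ->
  (#|B| + 2 <= #|A| + #|C|)%N ->
  forall f, (forall l, l \in C -> \sum_(j in B) f j * G j l = 0) ->
    exists u, forall j, j \in B -> f j = \sum_(i in A) u i * F i j.
Proof.
move=> FG /rank_fun_mx_ge rF kerG cardBAC f /fun_rv0 fG; apply: sub_fun_mxP.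
have := rank_fun_mx_ge kerG; rewrite -fun_mx_tr mxrank_tr => rG.
have sFG : (fun_mx A B F <= kermx (fun_mx B C G))%MS.
  apply/sub_kermxP/matrixP => k l; rewrite !mxE.
  rewrite -[RHS](FG (enum_val k) (enum_val l)) ?enum_valP // [RHS]big_enum_val.
  by apply: eq_bigr => m _; rewrite !mxE.
have -> : (fun_mx A B F :=: kermx (fun_mx B C G))%MS.
  apply/eqmxP; rewrite -mxrank_leqif_eq // eqn_leq mxrankS //= mxrank_ker.
  lia.
by apply/sub_kermxP; rewrite fun_rvM.
Qed.

(** The converse count: the nonzero kernel vectors [wF] and [wG] bound the ranks by [#|A| - 1] and
    [#|C| - 1], while exactness makes the ranks add up to at least [#|B|]. *)
Lemma card_of_exact wF i wG l :
  i \in A -> wF i != 0 ->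
  (forall j, j \in B -> \sum_(i in A) wF i * F i j = 0) ->
  l \in C -> wG l != 0 ->
  (forall j, j \in B -> \sum_(l in C) wG l * G j l = 0) ->
  (forall f, (forall l, l \in C -> \sum_(j in B) f j * G j l = 0) ->
    exists u, forall j, j \in B -> f j = \sum_(i in A) u i * F i j) ->
  (#|B| + 2 <= #|A| + #|C|)%N.
Proof.
move=> iA wi /(rank_fun_mx_lt iA wi) rF lC wl /(rank_fun_mx_lt lC wl).
rewrite -fun_mx_tr mxrank_tr => rG ex.
suff /mxrankS : (kermx (fun_mx B C G) <= fun_mx A B F)%MS.
  by rewrite mxrank_ker; lia.
apply/row_subP => k.
have [f fE] := fun_rvP (row k (kermx (fun_mx B C G))); rewrite fE.
have /ex[u uE] : forall l, l \in C -> \sum_(j in B) f j * G j l = 0.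
  by apply/fun_rv0; rewrite -fun_rvM -fE; apply/sub_kermxP; rewrite row_sub.
apply/submxP; exists (fun_rv A u); rewrite fun_rvM.
by apply/rowP => m; rewrite !mxE uE ?enum_valP.
Qed.

End Exact.
End FunctionMatrices.

(** * Planarity *)

Section Classes.
Variables (T : finType) (cl : T -> {set T}).
Hypothesis clP : forall a b, (b \in cl a) = (cl a == cl b).

Lemma mem_class s a : s \in [set cl x | x : T] -> (a \in s) = (s == cl a).
Proof. by case/imsetP => x _ ->; apply: clP. Qed.

Lemma sum_class (R : nzRingType) (u : {set T} -> R) a :
  \sum_(s in [set cl x | x : T]) u s * (a \in s)%:R = u (cl a).
Proof.
have clT : cl a \in [set cl x | x : T] by apply: imset_f.
rewrite (bigD1 (cl a)) //= mem_class // eqxx mulr1 big1 ?addr0 // => s /andP[sP sa].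
by rewrite mem_class // (negbTE sa) mulr0.
Qed.

Lemma card_sum_class (B : {set T}) :
  #|B| = (\sum_(s in [set cl x | x : T]) #|s :&: B|)%N.
Proof.
rewrite -sum1_card (partition_big cl (mem [set cl x | x : T])) /=; last first.
  by move=> a _; apply: imset_f.
apply: eq_bigr => s sP; rewrite -sum1_card; apply: eq_bigl => a.
by rewrite in_setI (mem_class a sP) andbC eq_sym.
Qed.

Lemma card_preim_class (A : {set {set T}}) :
  A \subset [set cl x | x : T] ->
  #|[set a | cl a \in A]| = (\sum_(s in A) #|s|)%N.
Proof.
move=> /subsetP sA; rewrite -sum1_card (partition_big cl (mem A)) /=.
  apply: eq_bigr => s As; rewrite -sum1_card; apply: eq_bigl => a.
  rewrite inE (mem_class a (sA s As)) eq_sym.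
  by case: eqVneq => [<-|]; rewrite ?As ?andbF.
by move=> a; rewrite inE.
Qed.

End Classes.

Lemma porbit_class (T : finType) (p : {perm T}) a b :
  (b \in porbit p a) = (porbit p a == porbit p b).
Proof. by rewrite eq_porbit_mem porbit_sym. Qed.

Lemma porbit_step (T : finType) (p : {perm T}) a : porbit p (p a) = porbit p a.
Proof. exact: (porbit_perm p 1). Qed.

Lemma porbit_const (T : finType) (U : Type) (p : {perm T}) (h : T -> U) :
  (forall a, h (p a) = h a) -> forall a b, b \in porbit p a -> h b = h a.
Proof.
move=> hp a b /porbitP[k ->]; elim: k => [|k IH]; first by rewrite expg0 perm1.
by rewrite expgSr permM hp.
Qed.

Lemma card_porbits (T : finType) (p : {perm T}) n :
  (forall x, #|porbit p x| = n) -> #|T| = (n * #|porbits p|)%N.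
Proof.
move=> pn; rewrite -cardsT (card_sum_class (@porbit_class _ p)) mulnC.
rewrite -sum_nat_const; apply: eq_bigr => _ /imsetP[a _ ->].
by rewrite setIT pn.
Qed.

(** [B] is a union of orbits, each of size [n]. *)
Lemma dvdn_card_stable (T : finType) (p : {perm T}) n (B : {set T}) :
  (forall x, #|porbit p x| = n) -> (forall a, (p a \in B) = (a \in B)) ->
  (n %| #|B|)%N.
Proof.
move=> pn Bp; rewrite (card_sum_class (@porbit_class _ p)).
apply: dvdn_sum => _ /imsetP[a _ ->].
have Ba : {in porbit p a, forall b, (b \in B) = (a \in B)}.
  exact: (porbit_const (h := fun b => b \in B)).
case aB: (a \in B).
  by rewrite (setIidPl _) ?pn //; apply/subsetP => b /Ba->.
rewrite (_ : _ :&: _ = set0) ?cards0 //; apply/setP => b; rewrite !inE.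
by apply/negP => /andP[/Ba->]; rewrite aB.
Qed.

(** * Darts, corners and potentials *)

Section Diagram.
Variable K : link_diagram.
Implicit Types (a b x y : K) (c s r : {set K}).

Local Notation nd := (node K).
Local Notation ed := (edge K).
Local Notation fc := (face_of nd ed).

Lemma edgeK : involutive ed.
Proof.
move=> a; have := iter_porbit ed a; rewrite edge2 /=; exact.
Qed.

Lemma mem_segment a b : (b \in segment a) = (b == a) || (b == ed a).
Proof. by rewrite /segment porbit_traject edge2 /= !inE. Qed.

Lemma node4K a : nd (nd (nd (nd a))) = a.
Proof. by have := iter_porbit nd a; rewrite node4. Qed.

Lemma node_uniq a : uniq [:: a; nd a; nd (nd a); nd (nd (nd a))].
Proof. by have := uniq_traject_porbit nd a; rewrite node4. Qed.

Lemma node_neq a : nd a != a.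
Proof.
by have := node_uniq a; apply: contraTneq => /= ->; rewrite inE eqxx.
Qed.

Lemma mem_crossing a b :
  (b \in crossing a) = (b \in [:: a; nd a; nd (nd a); nd (nd (nd a))]).
Proof. by rewrite /crossing porbit_traject node4. Qed.

Lemma in_crossing a b : (b \in crossing a) = (crossing a == crossing b).
Proof. exact: porbit_class. Qed.

Lemma in_region a b : (b \in region a) = (region a == region b).
Proof. exact: porbit_class. Qed.

Lemma crossing_node a : crossing (nd a) = crossing a.
Proof. exact: porbit_step. Qed.

Lemma segment_edge a : segment (ed a) = segment a.
Proof. exact: porbit_step. Qed.

Lemma region_face a : region (fc a) = region a.
Proof. exact: porbit_step. Qed.

Lemma node_face a : nd (fc a) = ed a.
Proof. by rewrite permM permKV. Qed.

(** Connectedness of the diagram as an induction principle on darts. *)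
Lemma node_ind (P : K -> Prop) a :
  (forall x, P x -> P (nd x)) -> (forall x, P x -> P (ed x)) ->
  P a -> forall b, P b.
Proof.
move=> Pn Pe Pa b; have /connectP[p ep ->] := diagram_connected a b.
elim: p a Pa ep => //= x p IH a Pa /andP[/orP[]/eqP-> /IH]; apply.
  exact: Pn.
exact: Pe.
Qed.

Lemma card_segments : #|K| = (2 * #|segments K|)%N.
Proof. exact/card_porbits/edge2. Qed.

Lemma card_crossings : #|K| = (4 * #|crossings K|)%N.
Proof. exact/card_porbits/node4. Qed.

Lemma card_regions : #|regions K| = (#|crossings K| + 2)%N.
Proof. exact: diagram_planar. Qed.

(* [jump] and [on_cell] are the incidence matrices of segments with darts and
   of darts with crossing points and regions, darts standing for corners: the
   corner of [a] lies between the segments of [a] and [node a]. *)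
Definition cells (A N : {set {set K}}) : {set {set K} + {set K}} :=
  [set l | match l with inl c => c \in A | inr r => r \in N end].

Lemma card_cells A N : #|cells A N| = (#|A| + #|N|)%N.
Proof.
rewrite -!sum1_card big_sumType.
by congr (_ + _)%N; apply: eq_bigl => c; rewrite inE.
Qed.

Definition on_cell a (l : {set K} + {set K}) : rat :=
  match l with inl c => (a \in c)%:R | inr r => (a \in r)%:R end.

Definition jump (s : {set K}) a : rat := (a \in s)%:R - (nd a \in s)%:R.

Lemma sum_on_cells (A N : {set {set K}}) v a :
  A \subset crossings K -> N \subset regions K ->
  crossing a \in A -> region a \in N ->
  \sum_(l in cells A N) v l * on_cell a l
  = v (inl (crossing a)) + v (inr (region a)).
Proof.
move=> /subsetP sA /subsetP sN aA aN; rewrite big_sumType.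
congr (_ + _).
  rewrite (bigD1 (crossing a)) ?inE //= porbit_id mulr1 big1 ?addr0 // => c.
  rewrite inE => /andP[cA ca].
  by rewrite (mem_class (@porbit_class _ nd)) ?sA // (negbTE ca) mulr0.
rewrite (bigD1 (region a)) ?inE //= porbit_id mulr1 big1 ?addr0 // => c.
rewrite inE => /andP[cA ca].
by rewrite (mem_class (@porbit_class _ fc)) ?sN // (negbTE ca) mulr0.
Qed.

Lemma sum_mem (B c : {set K}) (f : K -> rat) :
  {subset c <= B} -> \sum_(a in B) f a * (a \in c)%:R = \sum_(a in c) f a.
Proof.
move=> cB; rewrite big_mkcond [RHS]big_mkcond; apply: eq_bigr => a _.
have := cB a; case: (a \in c) => [->//|_]; first by rewrite mulr1.
by rewrite mulr0 if_same.
Qed.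

Lemma sum_jump_crossing (V : zmodType) (h : K -> V) a :
  \sum_(b in crossing a) (h b - h (nd b)) = 0.
Proof.
rewrite sumrB; apply/eqP; rewrite subr_eq0; apply/eqP.
rewrite (reindex_inj (@perm_inj _ nd)); apply: eq_bigl => b.
by rewrite !in_crossing crossing_node.
Qed.

Lemma sum_jump_region (V : zmodType) (h : K -> V) a :
  (forall x, h (ed x) = h x) -> \sum_(b in region a) (h b - h (nd b)) = 0.
Proof.
move=> he; rewrite sumrB; apply/eqP; rewrite subr_eq0; apply/eqP.
rewrite [RHS](reindex_inj (@perm_inj _ fc)).
apply: eq_big => b; last by rewrite node_face he.
by rewrite !in_region region_face.
Qed.

(* The first cohomology of the sphere vanishes; here this is a count of ranks,
   with [diagram_planar] as the Euler formula. *)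
Lemma planar_potential (f : K -> rat) :
  (forall x, \sum_(a in crossing x) f a = 0) ->
  (forall x, \sum_(a in region x) f a = 0) ->
  exists h : K -> rat,
    (forall x, h (ed x) = h x) /\ forall x, f x = h x - h (nd x).
Proof.
move=> fc0 fr0.
have sum_jump u a : \sum_(s in segments K) u s * jump s a
    = u (segment a) - u (segment (nd a)).
  under eq_bigr do rewrite mulrBr.
  by rewrite sumrB !(sum_class (@porbit_class _ ed)).
have sum_cell v a : \sum_(l in cells (crossings K) (regions K)) v l * on_cell a l
    = v (inl (crossing a)) + v (inr (region a)).
  by rewrite sum_on_cells // imset_f.
suff [u uE] : exists u, forall a, a \in [set: K] ->
    f a = \sum_(s in segments K) u s * jump s a.
  exists (fun a => u (segment a)); split=> a; first by rewrite segment_edge.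
  by rewrite uE ?inE // sum_jump.
(* The complex runs from segments through corners to cells. By connectedness, the kernel on segments
   consists of constants, and the one on cells of multiples of the function 1 on crossing points, -1
   on regions. *)
apply: (@exact_of_card _ _ _ _ (segments K) [set: K]
  (cells (crossings K) (regions K)) jump on_cell (fun=> 1)
  (fun l => if l is inl _ then 1 else -1)).
- move=> s [c|r] /imsetP[a _ ->]; rewrite inE => /imsetP[b _ ->] /=.
    by rewrite sum_mem // sum_jump_crossing.
  rewrite sum_mem // (sum_jump_region (h := fun x => (x \in segment a)%:R)) //.
  by move=> x; rewrite /segment !porbit_class porbit_step.
- move=> u u0; have [a _] := card_gt0P (dart_neq0 K).
  exists (u (segment a)) => _ /imsetP[b _ ->]; rewrite mulr1.
  move: b; apply: (@node_ind _ a) => // x <-; last by congr u; apply: segment_edge.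
  by have /eqP := u0 x (in_setT _); rewrite sum_jump subr_eq0 => /eqP.
- move=> v v0; have [a _] := card_gt0P (dart_neq0 K).
  have vN b : v (inr (region b)) = - v (inl (crossing b)).
    by apply/eqP; rewrite -addr_eq0 addrC -sum_cell v0.
  have vE b : v (inl (crossing b)) = v (inl (crossing a)).
    move: b; apply: (@node_ind _ a) => // x <-; first by rewrite crossing_node.
    rewrite -node_face crossing_node; apply: oppr_inj.
    by rewrite -!vN region_face.
  exists (v (inl (crossing a))) => -[c|r]; rewrite inE => /imsetP[b _ ->].
    by rewrite mulr1 vE.
  by rewrite mulrN1 vN vE.
- rewrite card_cells cardsT card_regions card_segments.
  have := card_crossings; rewrite card_segments; lia.
- by move=> [c|r]; rewrite inE => /imsetP[a _ ->] /=; rewrite sum_mem ?fc0 ?fr0.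
Qed.

Lemma planar_potential_int (f : K -> int) e :
  (forall x, \sum_(a in crossing x) f a = 0) ->
  (forall x, \sum_(a in region x) f a = 0) ->
  exists h : K -> int,
    [/\ h e = 0, forall x, h (ed x) = h x & forall x, f x = h x - h (nd x)].
Proof.
move=> fc0 fr0; have [x|x|h [he hf]] := @planar_potential (fun a => (f a)%:~R).
- by rewrite -(rmorph_sum (intmul 1)) fc0.
- by rewrite -(rmorph_sum (intmul 1)) fr0.
(* Differences of [h] along [nd] are the integers [f x], so integrality spreads from [e]. *)
have /fin_all_exists[g gE] x : exists z : int, h x - h e = z%:~R.
  move: x; apply: (@node_ind _ e) => [x [z zE]|x|].
  - exists (z - f x); rewrite rmorphB /= -zE hf; lra.
  - by rewrite he.
  - by exists 0; rewrite subrr.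
exists g; split=> [|x|x]; apply: (@intr_inj rat).
- by rewrite -gE subrr.
- by rewrite -!gE he.
by rewrite rmorphB /= -!gE hf; lra.
Qed.

(** Thus [fc (ed a)] is the dart just clockwise of [a], and its corner is the one to the right of
    [a], in the region of [ed a]. *)
Lemma node_face_edge a : nd (fc (ed a)) = a.
Proof. by rewrite node_face edgeK. Qed.

Lemma face_edge_node a : fc (ed (nd a)) = a.
Proof. by apply: (@perm_inj _ nd); rewrite node_face_edge. Qed.

Lemma face_edgeE a : fc (ed a) = nd (nd (nd a)).
Proof. by apply: (@perm_inj _ nd); rewrite node_face_edge node4K. Qed.

Lemma region_edge_node a : region (ed (nd a)) = region a.
Proof. by rewrite -region_face face_edge_node. Qed.

Lemma card_over (A : {set {set K}}) :
  A \subset crossings K -> #|[set a : K | crossing a \in A]| = (4 * #|A|)%N.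
Proof.
move=> sA; rewrite (card_preim_class (@porbit_class _ nd)) // mulnC -sum_nat_const.
by apply: eq_bigr => c /(subsetP sA)/imsetP[x _ ->]; apply: node4.
Qed.

(* An edge-closed set of darts is even, and each crossing point outside [A]
   contributes zero or four darts to it. *)
Lemma even_over (A : {set {set K}}) (B : {set K}) :
  (forall a, (ed a \in B) = (a \in B)) ->
  (forall a, crossing a \notin A -> (nd a \in B) = (a \in B)) ->
  ~~ odd #|B :&: [set a | crossing a \in A]|.
Proof.
move=> /(dvdn_card_stable (@edge2 K)) Be Bn.
move: Be; rewrite dvdn2 -(cardsID [set a | crossing a \in A] B) oddD.
suff /dvdnP[k ->] : (4 %| #|B :\: [set a | crossing a \in A]|)%N.
  by rewrite oddM andbF addbF.
apply: (dvdn_card_stable (@node4 K)) => a; rewrite !inE crossing_node.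
by case: (boolP (crossing a \in A)) => // /Bn->.
Qed.

(* If both sides of [a] were in one region, the two corners next to [a] would
   form a cycle of corners, with a potential having a level set that contains
   [a] only at its crossing point. *)
Lemma region_edge_neq a : region (ed a) != region a.
Proof.
apply/eqP => ra.
pose f b : rat := (b == a)%:R - (b == fc (ed a))%:R.
have sum_eq (B : {set K}) x : \sum_(b in B) (b == x)%:R = (x \in B)%:R :> rat.
  case: (boolP (x \in B)) => xB.
    rewrite (bigD1 x) //= eqxx big1 ?addr0 // => b /andP[_ /negbTE->] //.
  by rewrite big1 // => b bB; case: eqP bB xB => // -> ->.
have [x|x|h [he hf]] := @planar_potential f.
- rewrite sumrB !sum_eq !in_crossing -(crossing_node (fc (ed a))).
  by rewrite node_face_edge subrr.
- by rewrite sumrB !sum_eq !in_region region_face ra subrr.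
have [un1 un2 un3] : [/\ a \notin [:: nd a; nd (nd a); nd (nd (nd a))],
    nd a \notin [:: nd (nd a); nd (nd (nd a))] & nd (nd a) \notin [:: nd (nd (nd a))]].
  by have /and4P[] := node_uniq a.
pose B := [set b | h b == h a].
have /negP[] : ~~ odd #|B :&: [set b | crossing b \in [set crossing a]]|.
  apply: even_over => b; rewrite !inE ?he // => ba.
  have : f b = 0.
    rewrite /f; case: (b =P a) ba => [->|_]; first by rewrite eqxx.
    case: (b =P fc (ed a)) => [->|_]; last by rewrite subrr.
    by rewrite -crossing_node node_face_edge eqxx.
  by rewrite hf => /eqP; rewrite subr_eq0 => /eqP->.
rewrite (_ : _ :&: _ = [set a]) ?cards1 //; apply/setP => b; rewrite !inE.
rewrite [crossing b == _]eq_sym -porbit_class mem_crossing.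
have := hf a; have := hf (nd a); rewrite /f face_edgeE.
move: un1 un2 un3; rewrite !inE !negb_or => /and3P[a1 a2 a3] /andP[b1 b2] b3.
rewrite eqxx (negbTE a3) (eq_sym _ a) (negbTE a1) (negbTE b2).
have := hf (nd (nd a)); rewrite /f face_edgeE (eq_sym _ a) (negbTE a2) (negbTE b3).
move=> h2 h1 h0; apply/andP/idP => [[/eqP hb] | /eqP->]; last by rewrite !eqxx.
rewrite /= in h0 h1 h2.
by case/or4P=> // /eqP bE; rewrite bE in hb; clear -h0 h1 h2 hb; exfalso; lra.
Qed.

Section Prime.
Hypothesis primeK : prime_diagram K.

(* Both sides of a curve through two distinct segments contain an end of each
   of them, so that a prime diagram has no such curve at all. *)
Lemma no_curve_through x y :
  region x = region y -> region (ed x) = region (ed y) -> segment x = segment y.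
Proof.
move=> rxy rexy; apply/eqP/negPn/negP => sxy.
have reach z : crossing z \in reached x y z by apply: imset_f; rewrite inE.
have [/setP/(_ (crossing x))|/setP/(_ (crossing (ed x)))] :=
  primeK (And3 sxy rxy rexy).
  by rewrite in_setU reach inE.
by rewrite in_setU reach inE.
Qed.

(** * Regions around a set of crossing points *)

Section OverSubset.
Variable A : {set {set K}}.
Hypotheses (sA : A \subset crossings K) (A0 : A != set0) (AT : A != crossings K).

Definition over : {set K} := [set a | crossing a \in A].

Definition linked : rel K :=
  [rel a b | (b == ed a) || (crossing a \notin A) && (crossing b == crossing a)].

(* The classes of [linked] correspond to the faces of the graph formed by the
   crossing points in [A] and the regions incident to them. *)
Definition face_class a := [set b | connect linked a b].

Lemma linked_sym : connect_sym linked.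
Proof.
apply: sym_connect_sym => a b /=; congr (_ || _).
  by apply/eqP/eqP => ->; rewrite edgeK.
by rewrite eq_sym; case: eqP => [->|_]; rewrite ?andbF.
Qed.

Lemma face_classP a b : (b \in face_class a) = (face_class a == face_class b).
Proof.
rewrite inE; apply/idP/eqP => [ab|/setP/(_ b)].
  by apply/setP => x; rewrite !inE (same_connect linked_sym ab).
by rewrite !inE connect0.
Qed.

Lemma face_class_edge a : face_class (ed a) = face_class a.
Proof.
apply/esym/eqP; rewrite -face_classP inE; apply: connect1.
by rewrite /linked /= eqxx.
Qed.

Lemma face_class_crossing a b :
  a \notin over -> crossing b = crossing a -> face_class b = face_class a.
Proof.
rewrite inE => aA cba; apply/esym/eqP; rewrite -face_classP inE.
by apply: connect1; rewrite /linked /= aA cba eqxx orbT.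
Qed.

Lemma over_crossing a b : crossing a = crossing b -> (a \in over) = (b \in over).
Proof. by rewrite !inE => ->. Qed.

Lemma over_neq0 : exists a, a \in over.
Proof.
have /set0Pn[c cA] := A0; have /imsetP[a _ cE] := subsetP sA c cA.
by exists a; rewrite inE /crossing -cE.
Qed.

(** Otherwise [over] would be closed under [nd] and [ed], and by connectedness [A] would be
    everything. *)
Lemma over_edge_open : exists2 a, a \in over & ed a \notin over.
Proof.
have [a aA] := over_neq0.
have [/forallP openE|/forallPn[b]] := boolP [forall b in over, ed b \in over]; last first.
  by rewrite negb_imply => /andP[bA ebA]; exists b.
case/eqP: AT; apply/eqP; rewrite eqEsubset sA.
apply/subsetP => _ /imsetP[b _ ->].
have : b \in over; last by rewrite inE.
move: b; apply: (@node_ind (fun b => b \in over) a) => // b.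
  by rewrite (over_crossing (crossing_node b)).
exact: (implyP (openE b)).
Qed.

(** A class disjoint from [over] would be closed under [nd] and [ed], hence contain all darts. *)
Lemma face_class_over a : exists b, b \in face_class a :&: over.
Proof.
apply/set0Pn/negP => /eqP/setP cl0.
have clT b : b \in face_class a.
  move: b; apply: (@node_ind (fun b => b \in face_class a) a) => [b|b|].
  - move=> ba; have := cl0 b; rewrite in_setI ba in_set0 /= => /negbT bA.
    by move: ba; rewrite !face_classP (@face_class_crossing b (nd b)) ?crossing_node ?bA.
  - by rewrite !face_classP face_class_edge.
  - by rewrite face_classP.
have [b bA] := over_neq0.
by have := cl0 b; rewrite in_setI clT bA inE.
Qed.

(** A class contains both ends of its segments and, outside [A], all darts of its crossing points;
    parity then turns nonempty into at least two. *)
Lemma card_face_class_over a :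
  (2 <= #|face_class a :&: over|)%N.
Proof.
have even : ~~ odd #|face_class a :&: over|.
  apply: even_over => b.
    by rewrite !face_classP face_class_edge.
  move=> bA; rewrite !face_classP (@face_class_crossing b (nd b)) ?crossing_node //.
  by rewrite inE.
have : (0 < #|face_class a :&: over|)%N.
  by apply/card_gt0P; apply: face_class_over.
lia.
Qed.

(* Follow the boundary of the region of [a]: it stays in the class of [a] until
   it arrives at a crossing point of [A]. *)
Lemma face_class_walk a : a \in over ->
  exists2 d, d \in region a & (ed d \in over) && (ed d \in face_class a).
Proof.
move=> aA; apply/exists_inP; apply: contraT => /exists_inPn noD.
have walk k : (fc ^+ k)%g a \in face_class a.
  elim: k => [|k IH]; first by rewrite expg0 perm1 face_classP.
  set d := (fc ^+ k)%g a in IH *.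
  have := noD d (mem_porbit _ _ _); rewrite expgSr permM -/d.
  rewrite !face_classP face_class_edge -face_classP IH andbT => edA.
  rewrite (@face_class_crossing (ed d) (fc d)) ?face_class_edge -?face_classP //.
  by rewrite -node_face crossing_node.
have : ed (nd a) \in region a by rewrite in_region region_edge_node.
move=> dr; case/negP: (noD _ dr); have /porbitP[k kE] := dr.
rewrite edgeK (over_crossing (crossing_node a)) aA /=.
by move: (walk k); rewrite -kE !face_classP -(face_class_edge (nd a)).
Qed.

Definition around : {set {set K}} := [set region a | a in over].

(** Euler's inequality for the graph formed by [A] and [around], with the darts over [A] as edges
    and the face classes as faces. It is the rank count for an exact complex from face classes
    through these darts to the cells. *)
Lemma card_face_classes :
  (4 * #|A| + 2 <= #|[set face_class a | a : K]| + (#|A| + #|around|))%N.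
Proof.
have [a aA] := over_neq0.
have sR : around \subset regions K.
  by apply/subsetP => _ /imsetP[b _ ->]; apply: imset_f.
have sum_jump u b : \sum_(s in [set face_class a | a : K]) u s * jump s b
    = u (face_class b) - u (face_class (nd b)).
  under eq_bigr do rewrite mulrBr.
  by rewrite sumrB !(sum_class face_classP).
have sum_cell v b : b \in over -> \sum_(l in cells A around) v l * on_cell b l
    = v (inl (crossing b)) + v (inr (region b)).
  by move=> bA; rewrite sum_on_cells //; [move: bA; rewrite inE | apply: imset_f].
rewrite -card_cells -(card_over sA).
apply: (@card_of_exact _ _ _ _ _ over _ jump on_cell
  (fun=> 1) (face_class a) (fun l => if l is inl _ then 1 else -1) (inl (crossing a))).
- exact: imset_f.
- exact: oner_neq0.
- by move=> b _; rewrite sum_jump subrr.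
- by move: aA; rewrite !inE.
- exact: oner_neq0.
- by move=> b bA; rewrite sum_cell // subrr.
(* Extended by zero, [f] has zero sums on the whole sphere; its potential is constant around
   crossing points outside [A], so it descends to face classes. *)
move=> f f0; pose g b := if b \in over then f b else 0.
have sum_g (B : {set K}) : \sum_(b in B) g b = \sum_(b in over) f b * (b \in B)%:R.
  rewrite big_mkcond [RHS]big_mkcond; apply: eq_bigr => b _; rewrite /g.
  by case: ifP; case: ifP; rewrite ?mulr1 ?mulr0.
have [x|x|h [he hg]] := @planar_potential g.
- case: (boolP (x \in over)) => xA.
    by rewrite sum_g; apply: (f0 (inl _)); move: xA; rewrite !inE.
  rewrite big1 // => b; rewrite in_crossing => /eqP xb.
  by rewrite /g -(over_crossing xb) (negbTE xA).
- case: (boolP (region x \in around)) => xA.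
    by rewrite sum_g; apply: (f0 (inr _)); rewrite inE.
  rewrite big1 // => b; rewrite in_region => /eqP xb.
  rewrite /g ifN //; apply: contra xA => bA.
  by rewrite xb; apply: imset_f.
have hcl b d : d \in face_class b -> h d = h b.
  rewrite inE => /connectP[p bp ->]; elim: p b bp => //= x p IH b /andP[bx /IH->].
  case/orP: bx => [/eqP-> //|/andP[bA /eqP xb]].
  have : x \in crossing b by rewrite in_crossing -xb.
  have nA y : y \in crossing b -> h (nd y) = h y.
    rewrite in_crossing => /eqP yb; have := hg y.
    rewrite /g -(over_crossing yb) inE (negbTE bA) => /esym/eqP.
    by rewrite subr_eq0 => /eqP.
  move=> /porbitP[k ->]; elim: k => [|k IHk]; first by rewrite expg0 perm1.
  by rewrite expgSr permM nA ?IHk // mem_porbit.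
(* The coefficient of a class is the value of [h] at any of its darts; 0 is a mere default for the
   empty set. *)
exists (fun s => if [pick b in s] is Some b then h b else 0) => b bA.
have pickE d : (if [pick b in face_class d] is Some b then h b else 0) = h d.
  by case: pickP => [e /hcl //|/(_ d)]; rewrite face_classP eqxx.
by rewrite sum_jump !pickE -hg /g bA.
Qed.

(* Each face class has at least two darts over [A], whence at least |A| + 2
   regions.  If there are no more, each class has exactly two; as they are on
   a common curve, they are the two ends of one segment by primality, so that
   [A] is closed under moving along segments. *)
Lemma card_around : (#|A| + 3 <= #|around|)%N.
Proof.
have cardA := card_over sA; have le_classes := card_face_classes.
rewrite leqNgt; apply/negP => lt_around.
set P := [set face_class a | a : K] in le_classes.
have two s : s \in P -> (2 <= #|s :&: over|)%N.
  by case/imsetP => a _ ->; apply: card_face_class_over.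
have sumP := card_sum_class face_classP over.
rewrite -/P -[over]/[set a | crossing a \in A] cardA -/over in sumP.
have [a aA eaA] := over_edge_open.
have aP : face_class a \in P by apply: imset_f.
(* At most [#|A| + 2] regions force at least [2 * #|A|] classes; these share [4 * #|A|] darts, two
   or more each, so none has more than two. *)
have ca2 : #|face_class a :&: over| = 2%N.
  move: sumP; rewrite (bigD1 (face_class a)) //=.
  have : (2 * #|P| <= 2 + \sum_(s in P | s != face_class a) #|s :&: over|)%N.
    rewrite mulnC -sum_nat_const (bigD1 (face_class a)) //= leq_add2l.
    by apply: leq_sum => s /andP[/two].
  have := two _ aP; move: (\sum_(s in P | _) _)%N => w.
  move: lt_around le_classes; move: #|face_class a :&: over| #|A| #|around| #|P|; lia.
have aI : a \in face_class a :&: over by rewrite in_setI face_classP eqxx.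
have cD1 : #|(face_class a :&: over) :\ a| = 1%N.
  by move: ca2; rewrite (cardsD1 a) aI add1n => -[].
have /card_gt0P[b] : (0 < #|(face_class a :&: over) :\ a|)%N by rewrite cD1.
rewrite in_setD1 => /andP[ba bI].
have abP d : d \in over -> d \in face_class a -> d = a \/ d = b.
  move=> dA da; have [->|da'] := eqVneq d a; [by left | right].
  have dI : d \in (face_class a :&: over) :\ a by rewrite in_setD1 da' in_setI da.
  have /eqP/cards1P[x xE] := cD1.
  have : b \in (face_class a :&: over) :\ a by rewrite in_setD1 ba.
  by move: dI; rewrite xE !inE => /eqP-> /eqP->.
have [bA ab] : b \in over /\ face_class b = face_class a.
  by move: bI; rewrite in_setI face_classP => /andP[/eqP-> ->].
(* The walk from [x] finds a segment whose far end is over [A] and in the class. That end is not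
   [x], since a segment has different regions on its two sides, so it is [y]. *)
have walk x y : x \in over -> face_class x = face_class a ->
    (forall d, d \in over -> d \in face_class a -> d = x \/ d = y) ->
    region x = region (ed y).
  move=> xA xa xyP; have [d] := face_class_walk xA.
  rewrite in_region xa => /eqP xd /andP[edA /(xyP _ edA)[] dE].
    by have := region_edge_neq d; rewrite dE xd eqxx.
  by rewrite xd -dE edgeK.
have rab : region a = region (ed b) by apply: walk.
have rba : region b = region (ed a) by apply: walk => // d dA /(abP _ dA)[]; auto.
(* A curve passes through [a] and [ed b]; primality makes them one segment, so [b] is [ed a], which
   is not over [A]. *)
have /setP/(_ b) : segment a = segment (ed b).
  by apply: no_curve_through; rewrite // edgeK.
rewrite !mem_segment edgeK eqxx orbT (negbTE ba) => /eqP bE.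
by rewrite -bE bA in eaA.
Qed.

End OverSubset.

(** * Existence of states *)

Hypothesis curlK : without_curls K.

(** A region with two opposite corners gives a closed curve through the crossing point; pushed off
    that point, it crosses the segments of [a] and of the dart [b] just clockwise of [a]. By
    primality [b] is the other end of [a], which makes a curl. *)
Lemma opposite_region_neq a : region (nd (nd a)) != region a.
Proof.
apply/eqP => ra.
pose b := fc (ed a).
have nb : nd b = a by apply: node_face_edge.
have bb : fc (ed b) = nd (nd a).
  by apply: (@perm_inj _ nd); rewrite node_face_edge /b face_edgeE.
have /setP/(_ b) : segment a = segment (ed b).
  apply: no_curve_through; first by rewrite -(region_face (ed b)) bb.
  by rewrite edgeK /b region_face.
rewrite !mem_segment edgeK eqxx orbT.
have /negbTE-> : b != a.
  by apply/eqP => ba; have := node_uniq b; rewrite nb ba /= inE eqxx.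
move=> /eqP ba.
have fb : fc b = b by apply: (@perm_inj _ nd); rewrite node_face nb {1}ba edgeK.
have /eqP[] : #|region b| != 1 by apply/curlK/imset_f.
apply/eqP/cards1P; exists b; apply/setP => y; rewrite inE.
apply/porbitP/eqP => [[k ->]|->]; first by rewrite permX_fix.
by exists 0; rewrite expg0 perm1.
Qed.

(** Consecutive corners are on the two sides of a segment, and opposite ones are settled by
    [opposite_region_neq]. Thus darts correspond to markers. *)
Lemma region_crossing_inj a b :
  crossing a = crossing b -> region a = region b -> a = b.
Proof.
move=> cab rab.
have : b \in crossing a by rewrite in_crossing cab.
have next x : region (nd x) != region x.
  by rewrite -(region_edge_node x) eq_sym; apply: region_edge_neq.
rewrite mem_crossing !inE => /or4P[] /eqP bE; move: rab (next a) (next b); rewrite bE //.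
- by move=> ->; rewrite eqxx.
- by move=> ab; have := opposite_region_neq a; rewrite ab eqxx.
- by rewrite node4K => ->; rewrite eqxx.
Qed.

Section Root.
Variable e : K.

Definition root_regions : {set {set K}} := [set region e; region (ed e)].

Lemma adjacent_root r : r \in regions K ->
  adjacent (segment e) r = (r \in root_regions).
Proof.
case/imsetP => a _ ->; rewrite -/(region a) !inE; apply/pred0Pn/orP => /= [[d]|].
  by rewrite mem_segment in_region => /andP[/orP[]/eqP-> ->]; [left | right].
by case=> ra; [exists e | exists (ed e)];
  rewrite mem_segment eqxx ?orbT in_region.
Qed.

Lemma card_root_regions : #|root_regions| = 2%N.
Proof. by rewrite cards2 eq_sym region_edge_neq. Qed.

Definition corner a : marker K := (crossing a, region a).

Lemma marker_of_dart a : is_marker (corner a).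
Proof.
apply/and3P; split; rewrite /= ?imset_f //.
by apply/pred0Pn; exists a; rewrite /= !porbit_id.
Qed.

Lemma is_markerP (m : marker K) :
  reflect (exists a, m = corner a) (is_marker m).
Proof.
apply: (iffP idP) => [|[a ->]]; last exact: marker_of_dart.
case: m => c r; rewrite /is_marker /=.
case/and3P=> /imsetP[x _ ->] /imsetP[y _ ->] /pred0Pn[a].
rewrite /= -/(crossing x) -/(region y) in_crossing in_region.
by rewrite /corner => /andP[/eqP-> /eqP->]; exists a.
Qed.

(** Hall's theorem matches the other crossing points with regions outside [X]; the surplus of three
    in [card_around] pays for the three regions of [X]. *)
Lemma state_with_marker a : region a \notin root_regions ->
  exists S : state (segment e), corner a \in val S.
Proof.
move=> aR; pose X := region a |: root_regions.
pose N (c : {set K}) := [set region b | b in c] :\: X.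
pose A := crossings K :\ crossing a.
have cardX : #|X| = 3%N by rewrite cardsU1 aR card_root_regions.
have aC : crossing a \in crossings K by apply: imset_f.
have [B BA|f fI fN] := @hall_marriage _ _ (region a) N A.
  have [->|B0] := eqVneq B set0; first by rewrite cards0.
  have [sB aB] : B \subset crossings K /\ crossing a \notin B.
    by move: BA; rewrite subsetD1 => /andP[].
  have BT : B != crossings K by apply: contraNneq aB => ->.
  have := card_around sB B0 BT.
  rewrite bigcup_setDl cardsD.
  have -> : \bigcup_(c in B) [set region b | b in c] = around B.
    apply/setP => r; apply/bigcupP/imsetP => [[c cB /imsetP[b bc ->]]|[b]].
      exists b => //; rewrite inE.
      suff -> : crossing b = c by [].
      have /imsetP[x _ cE] := subsetP sB c cB.
      by move: bc; rewrite cE -/(crossing x) in_crossing => /eqP.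
    rewrite inE => bB ->; exists (crossing b) => //.
    by apply: imset_f; apply: porbit_id.
  have := subset_leq_card (subsetIr (around B) X); rewrite cardX.
  by move: #|around B :&: X| #|around B| #|B|; lia.
pose m c := if c == crossing a then region a else f c.
have mR c : c \in crossings K -> exists2 b, crossing b = c & region b = m c.
  move=> cC; rewrite /m; have [->|ca] := eqVneq; first by exists a.
  have := fN c; rewrite in_setD1 ca cC => /(_ isT); rewrite in_setD => /andP[_].
  case/imsetP => b bc ->; exists b => //; apply/esym/eqP.
  by have /imsetP[x _ cE] := cC; move: bc; rewrite cE -/(crossing x) in_crossing.
have mX c : c \in crossings K -> c != crossing a -> m c \notin X.
  move=> cC ca; rewrite /m (negbTE ca).
  by have := fN c; rewrite in_setD1 ca cC => /(_ isT); rewrite in_setD => /andP[].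
have mI : {in crossings K &, injective m}.
  move=> c d cC dC; have [->|ca] := eqVneq c (crossing a);
    have [->|da] := eqVneq d (crossing a) => // E.
  - by have := mX d dC da; rewrite -E /m !inE !eqxx.
  - by have := mX c cC ca; rewrite E /m !inE !eqxx.
  - move: E; rewrite /m (negbTE ca) (negbTE da) => /fI.
    by apply; rewrite in_setD1 ?ca ?da.
have mN c : c \in crossings K -> m c \notin root_regions.
  move=> cC; have [->|ca] := eqVneq c (crossing a); first by rewrite /m eqxx.
  by have := mX c cC ca; rewrite in_setU1 negb_or => /andP[].
(* [m] is injective, and there are exactly two more regions than crossing points, so every region
   other than the two at the root is reached. *)
have mE : m @: crossings K = regions K :\: root_regions.
  apply/eqP; rewrite eqEcard; apply/andP; split.
    apply/subsetP => _ /imsetP[c cC ->]; rewrite in_setD mN //=.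
    by have [b _ <-] := mR c cC; apply: imset_f.
  rewrite card_in_imset // cardsD (setIidPr _) ?card_root_regions ?card_regions ?addnK //.
  by apply/subsetP => r; rewrite !inE => /orP[]/eqP->; apply: imset_f.
pose S := [set (c, m c) | c in crossings K].
have SE c r : ((c, r) \in S) = (c \in crossings K) && (r == m c).
  apply/imsetP/andP => [[d dC [-> ->]]|[cC /eqP->]]; last by exists c.
  by rewrite dC eqxx.
suff Sst : is_state (segment e) S.
  by exists (Sub S Sst); rewrite SubK SE aC /m eqxx /=.
apply/and3P; split.
- apply/forall_inP => _ /imsetP[c cC ->]; apply/is_markerP.
  by have [b <- <-] := mR c cC; exists b.
- apply/forall_inP => c cC; apply/cards1P; exists (c, m c).
  apply/setP => -[d r]; rewrite !inE SE xpair_eqE /=.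
  by have [->|] := eqVneq d c; rewrite ?cC ?andbT ?andbF.
apply/forall_inP => r rR; rewrite adjacent_root //.
have [rr|rr] := boolP (r \in root_regions).
  rewrite cards_eq0; apply/eqP/setP => -[d s]; rewrite !inE SE /=.
  by apply/negP => /andP[/andP[dC /eqP->] /eqP E]; rewrite -E (negbTE (mN d dC)) in rr.
have : r \in m @: crossings K by rewrite mE in_setD rr.
case/imsetP => c cC rE; apply/cards1P; exists (c, m c).
apply/setP => -[d s]; rewrite !inE SE xpair_eqE /= rE.
apply/andP/andP => [[/andP[dC /eqP->] /eqP /mI->]|[/eqP-> /eqP->]] //.
by rewrite cC eqxx.
Qed.

Lemma exists_state : inhabited (state (segment e)).
Proof.
have /set0Pn[r] : regions K :\: root_regions != set0.
  rewrite -card_gt0 cardsD; have := subset_leq_card (subsetIr (regions K) root_regions).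
  rewrite card_root_regions card_regions.
  have : (0 < #|K|)%N := dart_neq0 K; rewrite card_crossings; lia.
rewrite in_setD => /andP[rr /imsetP[a _ rE]].
by have [|S _] := @state_with_marker a; [rewrite /region -rE | exact: inhabits S].
Qed.

(** * Heights of states *)

Local Notation state := (state (segment e)).
Implicit Types (S T U : state) (X : {set K}).

Lemma corner_inj : injective corner.
Proof. by move=> a b [ca ra]; apply: region_crossing_inj. Qed.

Definition marked S a : bool := corner a \in val S.

Lemma card_corners_crossing X x :
  #|[set m in [set corner a | a in X] | m.1 == crossing x]| = #|X :&: crossing x|.
Proof.
rewrite -(card_imset _ corner_inj); congr #|pred_of_set _|; apply/setP => m.
rewrite inE; apply/andP/imsetP => [[/imsetP[a aX ->] /= /eqP ca]|[a]].
  by exists a; rewrite // in_setI aX in_crossing ca eqxx.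
rewrite in_setI in_crossing eq_sym => /andP[aX ca] ->.
by rewrite imset_f.
Qed.

Lemma card_corners_region X x :
  #|[set m in [set corner a | a in X] | m.2 == region x]| = #|X :&: region x|.
Proof.
rewrite -(card_imset _ corner_inj); congr #|pred_of_set _|; apply/setP => m.
rewrite inE; apply/andP/imsetP => [[/imsetP[a aX ->] /= /eqP ca]|[a]].
  by exists a; rewrite // in_setI aX in_region ca eqxx.
rewrite in_setI in_region eq_sym => /andP[aX ca] ->.
by rewrite imset_f.
Qed.

Lemma is_state_corners X :
  is_state (segment e) [set corner a | a in X] <->
  (forall x, #|X :&: crossing x| = 1%N) /\
  (forall x, #|X :&: region x| = (region x \notin root_regions) :> nat).
Proof.
split=> [/and3P[_ /forall_inP Xc /forall_inP Xr]|[Xc Xr]].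
  split=> x; first by rewrite -card_corners_crossing; apply/eqP/Xc/imset_f.
  rewrite -card_corners_region (eqP (Xr (region x) _)) ?imset_f //.
  by rewrite adjacent_root ?imset_f.
apply/and3P; split; apply/forall_inP.
- by move=> _ /imsetP[a _ ->]; apply: marker_of_dart.
- by move=> _ /imsetP[x _ ->]; rewrite -/(crossing x) card_corners_crossing Xc.
- move=> r rR; rewrite adjacent_root //; move: rR => /imsetP[x _ ->].
  by rewrite -/(region x) card_corners_region Xr.
Qed.

Lemma state_corners S : val S = [set corner a | a in [set a | marked S a]].
Proof.
apply/setP => m; apply/idP/imsetP => [mS|[a]]; last by rewrite inE => aS ->.
have /and3P[/forall_inP/(_ m mS)/is_markerP[a mE] _ _] := valP S.
by exists a => //; rewrite inE /marked -mE.
Qed.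

Definition mark S a : int := (marked S a)%:R.

Lemma sum_indicator X (B : {set K}) :
  \sum_(a in B) (a \in X)%:R = #|X :&: B|%:R :> int.
Proof.
rewrite -sum1_card natr_sum big_mkcond [RHS]big_mkcond; apply: eq_bigr => a _.
by rewrite in_setI; case: (a \in B); case: (a \in X).
Qed.

Lemma sum_mark S :
  (forall x, \sum_(a in crossing x) mark S a = 1) /\
  (forall x, \sum_(a in region x) mark S a = (region x \notin root_regions)%:R).
Proof.
have := valP S; rewrite {1}state_corners => /is_state_corners[Sc Sr].
have markE a : mark S a = (a \in [set a | marked S a])%:R by rewrite inE.
split=> x; under eq_bigr do rewrite markE.
  by rewrite sum_indicator Sc.
by rewrite sum_indicator Sr.
Qed.

Lemma marked_crossing_inj S a b :
  marked S a -> marked S b -> crossing a = crossing b -> a = b.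
Proof.
move=> aS bS cab; have := (sum_mark S).1 a; apply: contra_eq => ab.
rewrite (bigD1 a) ?porbit_id //= (bigD1 b) /=; last first.
  by rewrite in_crossing cab eqxx eq_sym.
rewrite {1 2}/mark aS bS.
have : 0 <= \sum_(i | (i \in crossing a) && (i != a) && (i != b)) mark S i.
  by apply: sumr_ge0 => i _; rewrite ler0n.
by move: (\sum_(i | _) _) => s /= s0; apply/eqP; lia.
Qed.

Lemma marked_nodeF S a : marked S (nd a) -> ~~ marked S a.
Proof.
move=> aS; apply: contra (node_neq a) => /(marked_crossing_inj aS) -> //.
exact: crossing_node.
Qed.

Lemma marked_node_faceF S a : marked S (fc (ed a)) -> ~~ marked S a.
Proof.
apply: contraL => aS; apply: marked_nodeF.
by rewrite node_face_edge.
Qed.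

Lemma marked_rootF S a : marked S a -> region a \notin root_regions.
Proof.
move=> aS; have := (sum_mark S).2 a; apply: contra_eqN => -> /=.
rewrite (bigD1 a) ?porbit_id //= {1}/mark aS.
have : 0 <= \sum_(i in region a | i != a) mark S i.
  by apply: sumr_ge0 => i _; rewrite ler0n.
by move: (\sum_(i in _ | _) _) => s /= s0; apply/eqP; lia.
Qed.

Lemma state_inj S T : mark S =1 mark T -> S = T.
Proof.
move=> ST; apply: val_inj; rewrite !state_corners.
suff -> : [set a | marked S a] = [set a | marked T a] by [].
apply/setP => a; rewrite !inE; have := ST a; rewrite /mark.
by case: marked; case: marked.
Qed.

(** The height of [T] relative to [S]: invariance under [ed] makes [h] a function on segments, whose
    coboundary is the change of marks. *)
Definition potential S T (h : K -> int) :=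
  [/\ h e = 0, forall x, h (ed x) = h x &
      forall x, mark T x = mark S x + h x - h (nd x)].

Lemma exists_potential S T : exists h, potential S T h.
Proof.
have [x|x|h [h0 he hf]] := @planar_potential_int (fun a => mark T a - mark S a) e.
- by rewrite sumrB !(sum_mark _).1 subrr.
- by rewrite sumrB !(sum_mark _).2 subrr.
by exists h; split=> // x; rewrite -addrA -hf addrC subrK.
Qed.

Lemma potential_unique S T h g : potential S T h -> potential S T g -> h =1 g.
Proof.
move=> [h0 he hf] [g0 ge gf]; apply: (@node_ind (fun x => h x = g x) e) => [x|x|].
- by have := hf x; have := gf x; lia.
- by rewrite he ge.
- by rewrite h0 g0.
Qed.

(** The bounds make the new marks 0 or 1. Their counts are right because a coboundary sums to zero
    around each crossing point and region. *)
Lemma state_of_potential S h :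
  h e = 0 -> (forall x, h (ed x) = h x) ->
  (forall x, 0 <= mark S x + h x - h (nd x) <= 1) ->
  exists T, potential S T h.
Proof.
move=> h0 he h01; pose X := [set x | mark S x + h x - h (nd x) == 1].
have XE x : (x \in X)%:R = mark S x + (h x - h (nd x)).
  by rewrite inE; case: eqP => [|] /=; have := h01 x; lia.
have Xst : is_state (segment e) [set corner a | a in X].
  apply/is_state_corners; split=> x; have := sum_indicator X.
    move/(_ (crossing x)); under eq_bigr do rewrite XE.
    rewrite big_split /= (sum_mark S).1 sum_jump_crossing addr0 => /esym/eqP.
    by rewrite pnatr_eq1 => /eqP.
  move/(_ (region x)); under eq_bigr do rewrite XE.
  rewrite big_split /= (sum_mark S).2 sum_jump_region // addr0 => /esym/eqP.
  by rewrite eqr_nat => /eqP.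
exists (Sub _ Xst); split=> // x.
by rewrite /mark /marked SubK (mem_imset _ _ corner_inj) XE addrA.
Qed.

(** No state marks a corner of the root regions, so [h] is constant along their boundaries, which
    start at [e] and [ed e]. *)
Lemma potential_root S T h a :
  potential S T h -> region a \in root_regions -> h a = 0.
Proof.
move=> [h0 he hf] aR.
have walk b : h b = 0 -> region b \in root_regions ->
    forall k, h ((fc ^+ k)%g b) = 0.
  move=> b0 bR; elim=> [|k IH]; first by rewrite expg0 perm1.
  have := hf ((fc ^+ k.+1)%g b).
  have unmarked U : mark U ((fc ^+ k.+1)%g b) = 0.
    rewrite /mark; case: (boolP (marked _ _)) => // /marked_rootF.
    by rewrite /region porbit_perm -/(region b) bR.
  by rewrite !unmarked expgSr permM node_face he IH; lia.
have h0e : h (ed e) = 0 by rewrite he.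
have : (region e == region a) || (region (ed e) == region a).
  by move: aR; rewrite !inE ![region a == _]eq_sym.
by rewrite -!in_region => /orP[] /porbitP[k ->]; apply: walk; rewrite // !inE eqxx ?orbT.
Qed.

(** * Transpositions as unit steps in height *)

Definition bump a b : int := (b \in segment a)%:R.

Lemma bump_edge a b : bump a (ed b) = bump a b.
Proof. by rewrite /bump !porbit_class porbit_step. Qed.

Lemma region_root_segment a : e \in segment a -> region a \in root_regions.
Proof.
rewrite mem_segment !inE => /orP[/eqP<-|/eqP->]; first by rewrite eqxx.
by rewrite edgeK eqxx orbT.
Qed.

Lemma bump_node a x : bump a (nd x) = ((x == fc (ed a)) || (x == fc a))%:R.
Proof.
rewrite /bump mem_segment; congr ((_ || _) : nat)%:R.
  by rewrite -[RHS](inj_eq (@perm_inj _ nd)) node_face_edge.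
by rewrite -[RHS](inj_eq (@perm_inj _ nd)) node_face.
Qed.

Lemma corner_face a : corner (fc a) = (crossing (ed a), region a).
Proof. by rewrite /corner region_face -(crossing_node (fc a)) node_face. Qed.

Lemma is_marker_val S m : m \in val S -> exists x, m = corner x.
Proof.
by move=> mS; have /and3P[/forall_inP/(_ m mS)/is_markerP] := valP S.
Qed.

Lemma corner_in_set2 x a b :
  (corner x \in [set corner a; corner b]) = (x == a) || (x == b).
Proof. by rewrite !inE !(inj_eq corner_inj). Qed.

(** The transposition moves the marks at [fc (ed a)] and [fc a] one corner counterclockwise, to [a]
    and [ed a]; this amounts to adding the coboundary of [bump a]. *)
Lemma transpositionP a S T :
  reflect [/\ marked S (fc (ed a)), marked S (fc a) & potential S T (bump a)]
    (ccw_transposition_at a (val S) (val T)).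
Proof.
have cE : (crossing a, region (ed a)) = corner (fc (ed a)).
  by rewrite corner_face edgeK.
rewrite /ccw_transposition_at -corner_face cE -!/(marked _ _).
rewrite -[(crossing a, _)]/(corner a) -[(crossing (ed a), _)]/(corner (ed a)).
rewrite -!/(marked _ _).
apply: (iffP and5P) => [[S1 S2 T1 T2 /eqP/setP ST]|[S1 S2 [b0 be bE]]].
  split=> //; split.
  - rewrite /bump; case: (boolP (e \in segment a)) => // /region_root_segment aR.
    by have := marked_rootF S2; rewrite region_face aR.
  - exact: bump_edge.
  move=> x; have := ST (corner x); rewrite !in_setD !corner_in_set2.
  rewrite -!/(marked _ _) bump_node /bump mem_segment /mark.
  have A1 : (x == a) ==> marked T x && ~~ marked S x.
    by apply/implyP => /eqP->; rewrite T1 marked_node_faceF.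
  have A2 : (x == ed a) ==> marked T x && ~~ marked S x.
    by apply/implyP => /eqP->; rewrite T2 marked_node_faceF ?edgeK.
  have A3 : (x == fc (ed a)) ==> marked S x && ~~ marked T x.
    by apply/implyP => /eqP->; rewrite S1 marked_nodeF ?node_face_edge.
  have A4 : (x == fc a) ==> marked S x && ~~ marked T x.
    by apply/implyP => /eqP->; rewrite S2 marked_nodeF ?node_face.
  move: (x == a) (x == ed a) (x == fc (ed a)) (x == fc a) A1 A2 A3 A4.
  by case: (marked S x); case: (marked T x) => -[] [] [] [].
have facts x : [/\ (x == a) ==> ~~ marked S x, (x == ed a) ==> ~~ marked S x,
    (x == fc (ed a)) ==> marked S x & (x == fc a) ==> marked S x].
  split; apply/implyP => /eqP-> //; apply: marked_node_faceF => //.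
  by rewrite edgeK.
have key x : (marked S x && (x != fc (ed a)) && (x != fc a)
              == marked T x && (x != a) && (x != ed a))
    && ((x == a) || (x == ed a) ==> marked T x).
  have := bE x; rewrite bump_node /bump mem_segment /mark; have [] := facts x.
  move: (x == a) (x == ed a) (x == fc (ed a)) (x == fc a).
  by case: (marked S x); case: (marked T x) => -[] [] [] [].
split=> //.
- by have /andP[_] := key a; rewrite eqxx.
- by have /andP[_] := key (ed a); rewrite eqxx orbT.
apply/eqP/setP => m; rewrite !in_setD.
have [/is_markerP[x ->]|mN] := boolP (is_marker m).
  rewrite !corner_in_set2 -!/(marked _ _) !negb_or.
  have /andP[/eqP + _] := key x.
  by rewrite -!andbA ![marked _ _ && _]andbC -!andbA.
have mF U : m \in val U = false.
  by apply: contraNF mN => /is_marker_val[x ->]; apply: marker_of_dart.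
by rewrite !mF !andbF.
Qed.

Lemma exists_transposition S a :
  marked S (fc (ed a)) -> marked S (fc a) ->
  exists T, ccw_transposition_at a (val S) (val T).
Proof.
move=> S1 S2.
have [||x|T ST] := @state_of_potential S (bump a).
- rewrite /bump; case: (boolP (e \in segment a)) => // /region_root_segment aR.
  by have := marked_rootF S2; rewrite region_face aR.
- exact: bump_edge.
- rewrite bump_node /bump mem_segment /mark.
  have A1 : (x == a) ==> ~~ marked S x.
    by apply/implyP => /eqP->; apply: marked_node_faceF.
  have A2 : (x == ed a) ==> ~~ marked S x.
    by apply/implyP => /eqP->; apply: marked_node_faceF; rewrite edgeK.
  have A3 : (x == fc (ed a)) ==> marked S x by apply/implyP => /eqP->.
  have A4 : (x == fc a) ==> marked S x by apply/implyP => /eqP->.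
  move: (x == a) (x == ed a) (x == fc (ed a)) (x == fc a) A1 A2 A3 A4.
  by case: (marked S x) => -[] [] [] [].
by exists T; apply/transpositionP.
Qed.

(* If no transposition is possible where [h > 0], then from each dart with
   [h > 0] one can turn clockwise over an unmarked corner, without decreasing
   [h].  These steps run into a cycle, and as potentials return to their value
   along it, its corners are unmarked in every state. *)
Lemma exists_transposition_below S T h :
  potential S T h -> (forall x, 0 <= h x) -> (exists x, h x != 0) ->
  exists a U, ccw_transposition_at a (val S) (val U) /\ h a != 0.
Proof.
move=> hST h_ge0 [x0 hx0]; have [h0 he hE] := hST.
pose flippable a := marked S (fc (ed a)) && marked S (fc a).
have [/existsP[a /andP[ha /andP[a1 a2]]]|/existsPn stuck] :=
    boolP [exists a, (h a != 0) && flippable a].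
  by have [U aU] := exists_transposition a1 a2; exists a, U.
(* Of the corners just clockwise of the two ends of [a], [g] takes one unmarked in [S]; by [stuck]
   there is one wherever [h] is nonzero. *)
pose g a := if marked S (fc (ed a)) then fc a else fc (ed a).
(* Turning over a corner unmarked in [S] raises a potential from [S] to [V] by the mark of [V] at
   that corner. *)
have step V k x : potential S V k -> h x != 0 ->
    k (g x) = k x + mark V (g x).
  move=> [k0 ke kE] hx; have := stuck x; rewrite hx /flippable /=.
  have := kE (g x).
  have -> : k (nd (g x)) = k x.
    by rewrite /g; case: ifP => _; rewrite ?node_face_edge ?node_face ?ke.
  move=> kg gS; suff : mark S (g x) = 0 by move=> S0; move: kg; rewrite S0; lia.
  by rewrite /mark /g; move: gS; case: ifPn => [_ /=|/negbTE -> //] /negbTE->.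
have mark_ge0 V x : 0 <= mark V x by rewrite /mark ler0n.
have gP x : h x != 0 -> h (g x) != 0.
  move=> hx; have := step _ _ _ hST hx; have := mark_ge0 T (g x).
  by have := h_ge0 x; move/eqP: hx => hx ? ? ->; apply/eqP; lia.
have giP n x : h x != 0 -> h (iter n g x) != 0.
  by move=> hx; elim: n => //= n; apply: gP.
have mono U k n x : potential S U k -> h x != 0 -> k x <= k (iter n g x).
  move=> kU hx; elim: n => //= n IH; rewrite (step _ _ _ kU) ?giP //.
  by have := mark_ge0 U (g (iter n g x)); lia.
have := looping_order g x0; rewrite /looping.
case/trajectP => m lt_m; set n := fingraph.order g x0 in lt_m *.
have -> : n = (n - m.+1 + m.+1)%N by rewrite subnK.
rewrite iterD iterS; set y := iter m g x0 => cyc.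
have hy : h y != 0 by apply: giP.
(* [g y] is off the root regions as [h] is nonzero there, so some state [V] marks it. The potential
   of [V] rises by 1 from [y] to [g y] and cannot fall on the way back to [y]. *)
have [V Vg] : exists V : state, marked V (g y).
  apply: state_with_marker => //; apply: contra (gP y hy) => gR.
  by rewrite (potential_root hST gR).
have [k kV] := exists_potential S V.
have := mono V k (n - m.+1)%N (g y) kV (gP y hy).
by rewrite cyc (step V k y kV hy) /mark Vg; lia.
Qed.

(** Heights are potentials measured from one fixed state; differences of two of them are again
    potentials. *)
Lemma height_function : exists ht : state -> K -> int,
  forall S T, potential S T (fun x => ht T x - ht S x).
Proof.
have [S0] := exists_state.
have /fin_all_exists[ht htP] : forall S, exists h, potential S0 S h.
  by move=> S; apply: exists_potential.
exists ht => S T; have [S1 S2 S3] := htP S; have [T1 T2 T3] := htP T.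
split=> [|x|x]; first by rewrite S1 T1 subrr.
  by rewrite S2 T2.
by rewrite S3 T3; lia.
Qed.

(** * The order of states as the order of heights *)

Section Order.
Variable ht : state -> K -> int.
Hypothesis htP : forall S T, potential S T (fun x => ht T x - ht S x).

Lemma height_inj S T : ht S =1 ht T -> S = T.
Proof.
move=> ST; apply: state_inj => x; have [_ _ ->] := htP S T.
by rewrite !ST; lia.
Qed.

(** Meant for minimum and maximum. [opB] allows heights to be taken relative to [S], and [op01] says
    that the bounds at a corner survive, [z] being the mark in [S]. *)
Lemma height_op (op : int -> int -> int) :
  (forall u, op u u = u) ->
  (forall u v w t z : int, 0 <= z + u - v <= 1 -> 0 <= z + w - t <= 1 ->
     0 <= z + op u w - op v t <= 1) ->
  (forall u v w : int, op (u - w) (v - w) = op u v - w) ->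
  forall S T, exists U, forall x, ht U x = op (ht S x) (ht T x).
Proof.
move=> op_id op01 opB S T; have [ST0 STe STE] := htP S T.
have [||x|U [U0 Ue UE]] := @state_of_potential S (fun x => op (ht S x) (ht T x) - ht S x).
- by move/eqP: ST0; rewrite subr_eq0 => /eqP->; rewrite op_id subrr.
- move=> x; rewrite -!opB !subrr; congr (op _ _); exact: STe.
- rewrite -!opB !subrr.
  apply: op01; rewrite ?addr0 ?subr0; first by rewrite /mark; case: marked.
  by have := STE x; rewrite -/(mark T x); rewrite /mark; case: marked; case: marked; lia.
exists U => x; have := potential_unique (And3 U0 Ue UE) (htP S U) x; lia.
Qed.

Definition height_le S T := forall x, ht S x <= ht T x.

Lemma transposition_height S T a : ccw_transposition_at a (val S) (val T) ->
  forall x, ht T x = ht S x + bump a x.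
Proof.
move=> /transpositionP[_ _ ST] x.
by rewrite -(potential_unique (htP S T) ST x) addrC subrK.
Qed.

Lemma transposition_le S T : ccw_transposition S T -> height_le S T /\ S != T.
Proof.
case/existsP => a /transposition_height aST; split=> [x|].
  by rewrite aST lerDl ler0n.
apply/eqP => ST; have := aST a; rewrite ST /bump porbit_id /=; lia.
Qed.

Lemma connect_le S T : connect (@ccw_transposition _ (segment e)) S T -> height_le S T.
Proof.
case/connectP => p pS ->; elim: p S pS => [|U p IH] S /=; first by move=> _ x.
case/andP => /transposition_le[SU _] /IH UT x.
exact: le_trans (SU x) (UT x).
Qed.

(** The transposition found is at a segment where the integer heights of [S] and [T] differ, so
    there is room for a step of 1. *)
Lemma exists_transposition_le S T : height_le S T -> S != T ->
  exists2 U, ccw_transposition S U & height_le U T.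
Proof.
move=> ST neq_ST.
have [x||a [U [aU ha]]] := exists_transposition_below (htP S T).
- by rewrite subr_ge0.
- apply/existsP; apply: contraR neq_ST; rewrite negb_exists => /forallP ST0.
  apply/eqP/height_inj => x; have := ST0 x; rewrite negbK; lia.
exists U; first by apply/existsP; exists a.
move=> x; rewrite (transposition_height aU) /bump.
case: (boolP (x \in segment a)) => [xa|_]; last by rewrite addr0.
have [_ he _] := htP S T.
have hx : ht T x - ht S x = ht T a - ht S a.
  exact: (porbit_const (h := fun x => ht T x - ht S x)) xa.
have := ST x; have := ST a; move/eqP: ha; rewrite /=; lia.
Qed.

(** Induction on the total gap in height, which every transposition shrinks. *)
Lemma le_connect S T : height_le S T -> connect (@ccw_transposition _ (segment e)) S T.
Proof.
have [n] := ubnP (\sum_x `|ht T x - ht S x|)%N.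
elim: n => // n IH in S *; rewrite ltnS => le_n ST.
have [->|neq_ST] := eqVneq S T; first exact: connect0.
have [U SU UT] := exists_transposition_le ST neq_ST.
apply: connect_trans (connect1 SU) (IH U _ UT).
apply: leq_trans le_n; case/existsP: SU => a /transposition_height aU.
rewrite (bigD1 a) // [X in (_ < X)%N](bigD1 a) //= -addSn.
apply: leq_add; last apply: leq_sum => x _.
  have := UT a; rewrite aU /bump porbit_id; lia.
have := UT x; rewrite aU; have : 0 <= bump a x by rewrite ler0n.
lia.
Qed.

(** Each transposition raises some height, so a nonempty sequence never returns to its start. *)
Lemma state_ltP S T : reflect (height_le S T /\ S != T) (state_lt S T).
Proof.
apply: (iffP existsP) => [[U /andP[SU /connect_le UT]]|]; last first.
  case=> ST /(exists_transposition_le ST)[U SU UT].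
  by exists U; rewrite SU le_connect.
have [SU' neq_SU] := transposition_le SU.
split=> [x|]; first exact: le_trans (SU' x) (UT x).
apply: contraNneq neq_SU => STE; apply/eqP/height_inj => x.
by apply/eqP; rewrite eq_le SU' /= STE UT.
Qed.

End Order.

Lemma state_lattice :
  exists (d : Order.disp_t) (T : finTBDistrLatticeType d) (f : state -> T),
    bijective f /\ forall S S', state_lt S S' <-> (f S < f S')%O.
Proof.
have [ht htP] := height_function; have [S0] := exists_state.
have [S T|S T|d [T [f [f_bij fP]]]] := @pointwise_lattice _ _ ht S0 (height_inj htP).
- by apply: (height_op htP) S T => [u|u v w t z|u v w]; lia.
- by apply: (height_op htP) S T => [u|u v w t z|u v w]; lia.
exists d, T, f; split=> // S S'; rewrite lt_def (inj_eq (bij_inj f_bij)) eq_sym.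
split=> [/(state_ltP htP)[SS ->]|/andP[SS /fP le]]; first exact/fP.
exact/(state_ltP htP).
Qed.

End Root.
End Prime.
End Diagram.

From mathcomp Require Import all_classical all_reals all_analysis.

Theorem corollary1p2 (R : realType) (K : link_diagram) (L : set 'rV[R]_3)
    (hL : diagram_of K L) (primeL : prime_link L) (primeK : prime_diagram K)
    (curlK : without_curls K) (i : {set K}) (hi : i \in segments K) :
  exists (d : Order.disp_t) (T : finTBDistrLatticeType d) (f : state i -> T),
    bijective f /\
    forall S S' : state i, state_lt S S' <-> (f S < f S')%O.
Proof.
have /imsetP[e _ ->] := hi.
exact: state_lattice primeK curlK e.
Qed.
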